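(* Let $A$ be a ring, $I$ a non-empty set and $\{e_{ii}\mid i\in I\}$ a family of elements of $A$. Then $\{e_{ii}\mid i\in I\}$ is a complete set of pairwise orthogonal idempotents of $A$ with index $I$ if and only if $A=\sum\{A_{ij}\mid i,j\in I\}$ is a gm ring with gm unit $\{e_{ii}\mid i\in I\}$ and $A_{ij}=e_{ii}Ae_{jj}$ for all $i,j\in I$.
   Context: Rings are associative and need not have a unity element. A family $\{e_{ii}\}_{i\in I}$ of elements of $A$ is a *complete set of pairwise orthogonal idempotents* with index $I$ if (i) $e_{ii}e_{jj}=\delta_{ij}e_{ii}$ for all $i,j\in I$; (ii) for each $x\in A$ there is a finite $F\subseteq I$ with $(\sum_{i\in F}e_{ii})x=x(\sum_{i\in F}e_{ii})=x$; (iii) $e_{ii}\neq0$ for all $i\in I$. $A=\sum\{A_{ij}\mid i,j\in I\}$ is an (inner) *generalized matrix ring* (gm ring) if the $A_{ij}$ are additive subgroups of $A$ with $A=\bigoplus_{i,j\in I}A_{ij}$ as additive groups and $A_{ij}A_{st}\subseteq\delta_{js}A_{it}$ (i.e. $A_{ij}A_{jt}\subseteq A_{it}$ and $A_{ij}A_{st}=0$ for $j\ne s$) for all $i,j,s,t\in I$. A *gm unit* of it is a family $\{e_{ii}\}_{i\in I}$ with $0\ne e_{ii}\in A_{ii}$ and $e_{ii}x=x=xe_{jj}$ for all $x\in A_{ij}$, $i,j\in I$. *)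

(* Defs.v *)
From HB Require Import structures.
From mathcomp Require Import all_boot ssralg finmap.
From mathcomp Require Import boolp classical_sets.

Set Implicit Arguments.
Unset Strict Implicit.
Unset Printing Implicit Defensive.

Import GRing.Theory.

Local Open Scope classical_set_scope.
Local Open Scope ring_scope.

(* In ring_scope, [*] would denote the product of a unital ring. *)
Local Notation "x * y" := ((x * y)%g) : ring_scope.

(* Associative rings without unit: the rings of ssralg are all unital, so we
   join an additive group with a semigroup. *)
HB.mixin Record Zmodule_Semigroup_isRng R of GRing.Zmodule R & Semigroup R := {
  rng_mulDl : forall x y z : R, (x + y) * z = x * z + y * z;
  rng_mulDr : forall x y z : R, x * (y + z) = x * y + x * z
}.

#[short(type="rngType")]
HB.structure Definition Rng :=
  { R of Zmodule_Semigroup_isRng R & GRing.Zmodule R & Semigroup R }.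

(* Index sets are choiceTypes, as finmap requires; with the axioms of
   [boolp] every type is one. *)

Definition complete_orthogonal_idempotents (A : rngType) (I : choiceType)
    (e : I -> A) : Prop :=
  [/\ forall i j, e i * e j = if i == j then e i else 0,
      forall x : A, exists F : {fset I},
        (\sum_(i <- F) e i) * x = x /\ x * (\sum_(i <- F) e i) = x
    & forall i, e i != 0].

(* [f] lists the components of [x]; it is finitely supported. *)
Definition internal_direct_sum (V : zmodType) (K : choiceType)
    (S : K -> set V) : Prop :=
  (forall k, zmod_closed (mem (S k))) /\
  (forall x : V, exists! f : {fsfun K -> V with 0},
     (forall k, S k (f k)) /\ x = \sum_(k <- finsupp f) f k).

Definition gm_ring (A : rngType) (I : choiceType) (B : I -> I -> set A) : Prop :=
  [/\ internal_direct_sum (fun p : I * I => B p.1 p.2),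
      forall i j t x y, B i j x -> B j t y -> B i t (x * y)
    & forall i j s t x y, j != s -> B i j x -> B s t y -> x * y = 0].

Definition gm_unit (A : rngType) (I : choiceType) (B : I -> I -> set A)
    (e : I -> A) : Prop :=
  (forall i, e i != 0 /\ B i i (e i)) /\
  (forall i j x, B i j x -> e i * x = x /\ x * e j = x).

Definition corner (A : rngType) (e f : A) : set A :=
  [set e * a * f | a in [set: A]].

(* Main.v *)
Require Import Defs.
From mathcomp Require Import all_boot ssralg finmap.
From mathcomp Require Import boolp classical_sets.

(** A complete set of orthogonal idempotents is a finitely approximated unity:
    each [x] is fixed on both sides by some finite sum [u] of the [e i].

    For the direct implication take [B i j] to be the corner [e i A e j].  The
    multiplication rules follow from orthogonality, and [e] is a gm unit because
    the corner consists of the [x] with [e i x = x = x e j] ([in_cornerP]).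
    Expanding [u x u], with [u] the sum over a finite set [F], writes [x] as
    the sum of its Peirce components [e i x e j] over [F `*` F]
    ([peirce_decomposition]); the other components vanish since [e i u = 0] and
    [u e i = 0] for [i] outside [F].  The components are unique because
    multiplying by [e i] on the left and [e j] on the right kills every corner
    but the [(i, j)] one ([peirce_component]).

    Conversely, a gm unit consists of orthogonal idempotents since [e i] lies
    in [B i i].  A given [x] has only finitely many nonzero components; the sum
    of [e i] over all row and column indices of these components fixes each of
    them on both sides, hence fixes [x] ([gm_unit_complete]). *)

Set Implicit Arguments.
Unset Strict Implicit.
Unset Printing Implicit Defensive.

Import GRing.Theory.

Local Open Scope classical_set_scope.
Local Open Scope ring_scope.
Local Open Scope fset_scope.

Local Notation "x * y" := ((x * y)%g) : ring_scope.

(** * Multiplication in a ring without unity *)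

Lemma rng_mul0l (A : rngType) (x : A) : 0 * x = 0.
Proof. by apply: (@addrI _ (0 * x)); rewrite -rng_mulDl !addr0. Qed.

Lemma rng_mul0r (A : rngType) (x : A) : x * 0 = 0.
Proof. by apply: (@addrI _ (x * 0)); rewrite -rng_mulDr !addr0. Qed.

Lemma rng_mulBl (A : rngType) (x y z : A) : (x - y) * z = x * z - y * z.
Proof. by apply: (addIr (y * z)); rewrite -rng_mulDl !subrK. Qed.

Lemma rng_mulBr (A : rngType) (x y z : A) : x * (y - z) = x * y - x * z.
Proof. by apply: (addIr (x * z)); rewrite -rng_mulDr !subrK. Qed.

Lemma rng_suml (A : rngType) (K : Type) (s : seq K) (f : K -> A) (x : A) :
  (\sum_(k <- s) f k) * x = \sum_(k <- s) f k * x.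
Proof.
by apply: (big_morph (fun y => y * x)) => [y z|]; rewrite ?rng_mulDl ?rng_mul0l.
Qed.

Lemma rng_sumr (A : rngType) (K : Type) (s : seq K) (f : K -> A) (x : A) :
  x * (\sum_(k <- s) f k) = \sum_(k <- s) x * f k.
Proof.
by apply: (big_morph (fun y => x * y)) => [y z|]; rewrite ?rng_mulDr ?rng_mul0r.
Qed.

(** * Finite sums *)

Lemma sum_fset_delta (V : zmodType) (K : choiceType) (F : {fset K})
    (f : K -> V) (i : K) :
  \sum_(k <- F) (if k == i then f k else 0) = if i \in F then f i else 0.
Proof.
case: ifPn => [iF|iNF].
  rewrite (big_fsetD1 i) //= eqxx big_seq big1 ?addr0 // => k.
  by rewrite !inE => /andP[/negPf ->].
rewrite big_seq big1 // => k kF; case: eqP => // ki.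
by rewrite -ki kF in iNF.
Qed.

Lemma sum_fsetM (V : zmodType) (K L : choiceType) (E : {fset K}) (F : {fset L})
    (f : K * L -> V) :
  \sum_(p <- E `*` F) f p = \sum_(i <- E) \sum_(j <- F) f (i, j).
Proof.
rewrite (perm_big _ (enum_imfset2 _ _)) ?big_allpairs_dep //=.
by move=> [i j] [i' j'] _ _ [-> ->].
Qed.

Lemma sum_finsupp_sub (V : zmodType) (K : choiceType)
    (f : {fsfun K -> V with 0}) (F : {fset K}) :
  finsupp f `<=` F -> \sum_(k <- finsupp f) f k = \sum_(k <- F) f k.
Proof.
by move=> sF; apply: big_fset_incl => // k _; apply: fsfun_dflt.
Qed.

(** * Peirce corners of orthogonal idempotents *)

Definition orthogonal_idempotents (A : rngType) (I : choiceType) (e : I -> A) :=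
  forall i j, e i * e j = if i == j then e i else 0.

(** For idempotents, the corner is the common fixed-point set of two
    multiplications, which is the form in which a gm unit describes it. *)
Lemma in_cornerP (A : rngType) (e f x : A) :
  e * e = e -> f * f = f -> corner e f x <-> e * x = x /\ x * f = x.
Proof.
move=> ee ff; split=> [[a _ <-]|[ex xf]]; last by exists x; rewrite // ex.
by rewrite -!mulgA ff !mulgA ee.
Qed.

Lemma zmod_closed_corner (A : rngType) (e f : A) :
  zmod_closed (mem (corner e f)).
Proof.
split=> [|x y]; rewrite !inE.
  by exists 0; rewrite // rng_mul0r rng_mul0l.
move=> [a _ <-] [b _ <-]; exists (a - b) => //.
by rewrite rng_mulBr rng_mulBl.
Qed.

(** Multiplying on the left by one idempotent and on the right by another kills
    every other corner, so the value of a sum of corner elements determines its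
    terms: this is the uniqueness half of the direct sum decomposition. *)
Lemma peirce_component (A : rngType) (I : choiceType) (e : I -> A)
    (f : {fsfun I * I -> A with 0}) (p : I * I) :
  orthogonal_idempotents e ->
  (forall k, corner (e k.1) (e k.2) (f k)) ->
  e p.1 * (\sum_(k <- finsupp f) f k) * e p.2 = f p.
Proof.
move=> oe fe; rewrite rng_sumr rng_suml.
have pick k : e p.1 * f k * e p.2 = if k == p then f k else 0.
  have [a _ <-] := fe k; rewrite !mulgA oe -[_ * e k.2 * _]mulgA oe.
  case: k p => [i j] [s t]; rewrite xpair_eqE /= (eq_sym s).
  by case: (i =P s) (j =P t) => [->|_] [->|_]; rewrite ?rng_mul0l ?rng_mul0r.
rewrite (eq_bigr _ (fun k _ => pick k)) sum_fset_delta.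
by case: ifPn => // /fsfun_dflt ->.
Qed.

Lemma sum_idem_mull (A : rngType) (I : choiceType) (e : I -> A)
    (F : {fset I}) (i : I) : orthogonal_idempotents e ->
  (\sum_(j <- F) e j) * e i = if i \in F then e i else 0.
Proof.
move=> oe; rewrite rng_suml -sum_fset_delta.
by apply: eq_bigr => j _; rewrite oe.
Qed.

Lemma sum_idem_mulr (A : rngType) (I : choiceType) (e : I -> A)
    (F : {fset I}) (i : I) : orthogonal_idempotents e ->
  e i * (\sum_(j <- F) e j) = if i \in F then e i else 0.
Proof.
move=> oe; rewrite rng_sumr -sum_fset_delta.
by apply: eq_bigr => j _; rewrite oe eq_sym; case: eqP => [->|].
Qed.

(** Expand [u x u], where [u] is the sum of the [e i] over [F]. *)
Lemma peirce_decomposition (A : rngType) (I : choiceType) (e : I -> A)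
    (F : {fset I}) (x : A) :
  (\sum_(i <- F) e i) * x = x -> x * (\sum_(i <- F) e i) = x ->
  x = \sum_(p <- F `*` F) e p.1 * x * e p.2.
Proof.
move=> Fx xF; rewrite sum_fsetM /= -[LHS]xF -[X in X * _]Fx !rng_suml.
by apply: eq_bigr => i _; rewrite rng_sumr.
Qed.

(** * From idempotents to a generalized matrix ring *)

Lemma peirce_direct_sum (A : rngType) (I : choiceType) (e : I -> A) :
  complete_orthogonal_idempotents e ->
  internal_direct_sum (fun p : I * I => corner (e p.1) (e p.2)).
Proof.
move=> [oe ce _]; split=> [k|x]; first exact: zmod_closed_corner.
have [F [Fx xF]] := ce x.
pose f : {fsfun I * I -> A with 0} :=
  [fsfun p in F `*` F => e p.1 * x * e p.2].
have fE p : f p = e p.1 * x * e p.2.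
  rewrite fsfunE in_fsetM; case: ifPn => //; rewrite negb_and.
  (* An index outside F is orthogonal to the sum over F, which fixes x. *)
  case/orP => /negPf pF.
    by rewrite -Fx mulgA sum_idem_mulr // pF !rng_mul0l.
  by rewrite -xF -!mulgA sum_idem_mull // pF !rng_mul0r.
exists f; split=> [|g [ge xg]].
  split=> [k|]; first by rewrite fE; exists x.
  rewrite (sum_finsupp_sub (finsupp_sub _ _ _)) {1}(peirce_decomposition Fx xF).
  by apply: eq_bigr => p _; rewrite -fE.
by apply/fsfunP => p; rewrite fE xg peirce_component.
Qed.

Lemma gm_ring_corner (A : rngType) (I : choiceType) (e : I -> A) :
  complete_orthogonal_idempotents e ->
  gm_ring (fun i j => corner (e i) (e j)).
Proof.
move=> ce; have [oe _ _] := ce.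
split; first exact: peirce_direct_sum.
  move=> i j t _ _ [a _ <-] [b _ <-].
  by exists (a * e j * e j * b) => //; rewrite !mulgA.
move=> i j s t _ _ /negPf js [a _ <-] [b _ <-].
by rewrite !mulgA -[_ * e j * _]mulgA oe js rng_mul0r !rng_mul0l.
Qed.

Lemma gm_unit_corner (A : rngType) (I : choiceType) (e : I -> A) :
  complete_orthogonal_idempotents e ->
  gm_unit (fun i j => corner (e i) (e j)) e.
Proof.
move=> [oe _ nz]; have ee i : e i * e i = e i by rewrite oe eqxx.
split=> [i|i j x /in_cornerP]; last exact.
by split; last by apply/in_cornerP.
Qed.

(** * From a gm unit to idempotents *)

Lemma gm_unit_orthogonal (A : rngType) (I : choiceType) (B : I -> I -> set A)
    (e : I -> A) :
  gm_ring B -> gm_unit B e -> orthogonal_idempotents e.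
Proof.
move=> [_ _ B0] [eB eu] i j; case: eqP => [<-|/eqP ij].
  exact: (eu _ _ _ (eB i).2).1.
exact: B0 ij (eB i).2 (eB j).2.
Qed.

(** Each component of [x] is fixed by the idempotents of its row and of its
    column, and any larger sum of orthogonal idempotents still fixes it; so one
    finite set of indices serves all the components of [x]. *)
Lemma gm_unit_complete (A : rngType) (I : choiceType) (B : I -> I -> set A)
    (e : I -> A) :
  gm_ring B -> gm_unit B e ->
  forall x : A, exists F : {fset I},
    (\sum_(i <- F) e i) * x = x /\ x * (\sum_(i <- F) e i) = x.
Proof.
move=> gB ue x; have oe := gm_unit_orthogonal gB ue.
have [[_ dB] _ _] := gB; have [_ eu] := ue.
have [f [[fB ->] _]] := dB x.
(* All row and column indices of the nonzero components of x. *)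
exists ([fset k.1 | k in finsupp f] `|` [fset k.2 | k in finsupp f]).
have fu k : e k.1 * f k = f k /\ f k * e k.2 = f k by apply: eu.
split; [rewrite rng_sumr | rewrite rng_suml].
  apply: eq_big_seq => k kf; have [kE _] := fu k.
  by rewrite -kE mulgA sum_idem_mull // in_fsetU in_imfset.
apply: eq_big_seq => k kf; have [_ kE] := fu k.
by rewrite -kE -mulgA sum_idem_mulr // in_fsetU orbC in_imfset.
Qed.

Theorem theorem1p2 (A : rngType) (I : choiceType)
    (I_nonempty : ([set: I] !=set0)%classic) (e : I -> A) :
  complete_orthogonal_idempotents e <->
  exists B : I -> I -> set A,
    [/\ gm_ring B, gm_unit B e & forall i j : I, B i j = corner (e i) (e j)].
Proof.
split=> [ce|[B [gB ue _]]].
  exists (fun i j => corner (e i) (e j)).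
  by split=> //; [apply: gm_ring_corner | apply: gm_unit_corner].
split; first exact: gm_unit_orthogonal gB ue.
  exact: gm_unit_complete gB ue.
by move=> i; case: (ue.1 i).
Qed.
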